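(* Let $n$ and $m$ be positive integers. For all nonnegative integers $d_1,\dots,d_{n-1}$, \[ |\mathrm{SB}(n,m;d_1,\dots,d_{n-1})| = \left(1!\,2!\cdots (n-1)!\right)^m \cdot |\mathrm{YB}(n,m;d_1,\dots,d_{n-1})|, \] and consequently \[ |\mathrm{SB}(n,m)| = \left(1!\,2!\cdots (n-1)!\right)^m \cdot |\mathrm{YB}(n,m)|. \]
   Context: The shifted staircase of size $n$ is the set of cells $(i,j)$ (row $i$, column $j$) with $1\le i\le j\le n$; the cell $(i,i)$ is its $i$th diagonal cell. Take $m$ copies $\lambda^{(1)},\dots,\lambda^{(m)}$ (called pages) of the shifted staircase of size $n$, and for each $1\le i\le n$ identify the $i$th diagonal cells of all pages into one cell; the result has $n+m\binom n2$ cells. An $(n,m)$-Selberg book is a filling of these cells with the integers $1,2,\dots,n+m\binom n2$, each used exactly once, such that in each page, the entry of every cell $(i,j)$ with $i<j$ is larger than the entry of the $i$th diagonal cell and smaller than the entry of the $j$th diagonal cell. An $(n,m)$-Young book is an $(n,m)$-Selberg book in which, additionally, in each page the entries increase from left to right along each row and from top to bottom along each column. $\mathrm{SB}(n,m)$ and $\mathrm{YB}(n,m)$ denote the sets of $(n,m)$-Selberg books and $(n,m)$-Young books. If $e_i$ denotes the entry of the $i$th diagonal cell, $\mathrm{SB}(n,m;d_1,\dots,d_{n-1})$ (resp. $\mathrm{YB}(n,m;d_1,\dots,d_{n-1})$) is the set of $(n,m)$-Selberg (resp. Young) books with $d_i=e_{i+1}-e_i-1$ for $i=1,\dots,n-1$.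 *)

(* Defs.v *)
From mathcomp Require Import all_boot.
Set Implicit Arguments. Unset Strict Implicit. Unset Printing Implicit Defensive.

(* Cells of an (n,m)-book: the n shared diagonal cells ('I_n, cell i = (i,i)),
   plus, for each page k < m, the off-diagonal cells (i,j) with i < j.
   Indices are 0-based (paper's index = ours + 1). *)
Definition offcell (n m : nat) :=
  {p : 'I_m * ('I_n * 'I_n) | p.2.1 < p.2.2}.
Definition cell (n m : nat) := ('I_n + offcell n m)%type.

Definition ncells (n m : nat) := n + m * 'C(n, 2).

(* A filling assigns to each cell a value in 'I_(ncells n m); the entry
   written in the cell is that value + 1, so entries lie in 1..ncells. *)
Definition filling (n m : nat) := {ffun cell n m -> 'I_(ncells n m)}.

(* Entry of cell (i,j) of page k (meaningful for i <= j: when i = j it is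
   the i-th diagonal cell, shared by all pages). *)
Definition pentry (n m : nat) (f : filling n m) (k : 'I_m) (i j : 'I_n) : nat :=
  if @insub _ (fun p : 'I_m * ('I_n * 'I_n) => p.2.1 < p.2.2) (offcell n m) (k, (i, j))
    is Some p then (f (inr p)).+1 else (f (inl i)).+1.

Definition diag_entry (n m : nat) (f : filling n m) (i : 'I_n) : nat := (f (inl i)).+1.

(* each integer 1..ncells used exactly once (#|cell n m| = ncells n m) *)
Definition is_bijective_filling (n m : nat) (f : filling n m) : bool :=
  injectiveb f.

Definition selberg_cond (n m : nat) (f : filling n m) : bool :=
  [forall k : 'I_m, forall i : 'I_n, forall j : 'I_n,
     (i < j) ==> (pentry f k i i < pentry f k i j < pentry f k j j)].

Definition young_cond (n m : nat) (f : filling n m) : bool :=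
  [forall k : 'I_m, forall i : 'I_n, forall j : 'I_n, forall j' : 'I_n,
     (i <= j < j') ==> (pentry f k i j < pentry f k i j')] &&
  [forall k : 'I_m, forall i : 'I_n, forall i' : 'I_n, forall j : 'I_n,
     (i < i' <= j) ==> (pentry f k i j < pentry f k i' j)].

Definition SB (n m : nat) : {set filling n m} :=
  [set f | is_bijective_filling f && selberg_cond f].

Definition YB (n m : nat) : {set filling n m} :=
  [set f | [&& is_bijective_filling f, selberg_cond f & young_cond f]].

(* gap condition: d_i = e_{i+1} - e_i - 1, for i = 1..n-1 (0-based here) *)
Definition gaps_cond (n m : nat) (d : 'I_n.-1 -> nat) (f : filling n m) : bool :=
  [forall i : 'I_n.-1, forall a : 'I_n, forall b : 'I_n,
     ((val a == val i) && (val b == (val i).+1)) ==>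
       (diag_entry f b == diag_entry f a + d i + 1)].

Definition SBd (n m : nat) (d : 'I_n.-1 -> nat) : {set filling n m} :=
  [set f in SB n m | gaps_cond d f].

Definition YBd (n m : nat) (d : 'I_n.-1 -> nat) : {set filling n m} :=
  [set f in YB n m | gaps_cond d f].

Arguments SB n m : clear implicits.
Arguments YB n m : clear implicits.
Arguments SBd n m d : clear implicits.
Arguments YBd n m d : clear implicits.

(* Main.v *)
Require Import Defs.
From mathcomp Require Import all_boot all_algebra.
Set Implicit Arguments. Unset Strict Implicit. Unset Printing Implicit Defensive.

(** Fix the diagonal e. The remaining entries form a map from the off-diagonal
    cells onto the set C of values not used by e. Relax the inequalities to
    half-open ones (weak along rows, strict along columns; for Selberg books
    [e_i <= v < e_j]), which changes nothing for injective fillings, and count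
    all maps with values in an arbitrary set A. The pages are then independent.
    With [a_i] the number of elements of A below [e_i], a Selberg page has
    [prod_(i < j) (a_j - a_i)] such maps, while a Young page has
    [det 'C(a_j, i)], by induction on the size: removing the diagonal leaves a
    smaller page whose diagonal interlaces e, and the determinant can be summed
    column by column. By Vandermonde these numbers differ by the factor
    [1! 2! ... (n-1)!]. Being valid for every A, the proportionality passes from
    maps into A to maps onto A, in particular to A = C. *)

(** * Maps into a set versus maps onto it *)

Definition ffun_image (T V : finType) (h : {ffun T -> V}) : {set V} :=
  [set h t | t : T].

(** Maps into [A] are sorted by their image [B]. By induction on [#|A|] the terms with [B] proper
    agree up to the factor [K]; cancelling them leaves the term [B = A]. *)
Lemma card_onto_scale (T V : finType) (P Q : pred {ffun T -> V}) (K : nat) :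
  (forall A : {set V}, #|[set h | (ffun_image h \subset A) && P h]| =
        K * #|[set h | (ffun_image h \subset A) && Q h]|) ->
  forall A : {set V}, #|[set h | (ffun_image h == A) && P h]| =
        K * #|[set h | (ffun_image h == A) && Q h]|.
Proof.
have dec (R : pred {ffun T -> V}) A :
  #|[set h | (ffun_image h \subset A) && R h]| =
  \sum_(B : {set V} | B \subset A) #|[set h | (ffun_image h == B) && R h]|.
  rewrite -sum1_card (partition_big (@ffun_image T V) (fun B => B \subset A)) /=;
    last by move=> h; rewrite inE => /andP[].
  apply: eq_bigr => B sBA; rewrite -sum1_card; apply: eq_bigl => h.
  rewrite !inE; case: eqP => [->|]; last by rewrite andbF.
  by rewrite sBA andbT.
move=> eqPQ A; have [k] := ubnP #|A|; elim: k A => // k IHk A ltAk.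
have := eqPQ A; rewrite !dec (bigD1 A) //= [in RHS](bigD1 A) //= mulnDr.
rewrite [X in _ + X](eq_bigr (fun B => K * #|[set h | (ffun_image h == B) && Q h]|)).
  by rewrite -big_distrr /= => /addIn.
move=> B /andP[sBA neqBA]; apply: IHk.
rewrite -ltnS; apply: leq_trans ltAk; rewrite ltnS; apply: proper_card.
by rewrite properEneq neqBA.
Qed.

(** * The determinant of binomial coefficients *)

Section Determinant.
Local Open Scope ring_scope.
Import GRing.Theory.

Definition binmx (n : nat) (a : 'I_n -> nat) : 'M[int]_n :=
  \matrix_(i, j) ('C(a j, i))%:Z.

(** Column differences match the recursion on pages: [sum_bin_rank] writes such a difference as a
    sum over the possible values of one cell of the new diagonal. *)
Lemma det_binmxS (n : nat) (a : 'I_n.+1 -> nat) :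
  \det (binmx a) =
  \det (\matrix_(i < n, j < n) (('C(a (lift ord0 j), i.+1))%:Z
           - ('C(a (widen_ord (leqnSn n) j), i.+1))%:Z)).
Proof.
(* Right multiplication by U subtracts from each column its predecessor. *)
pose U : 'M[int]_(n.+1) := \matrix_(i, j) ((i == j)%:R - (i.+1 == j :> nat)%:R).
have detU : \det U = 1.
  rewrite -det_tr det_trig; last first.
    apply/is_trig_mxP => i j ltij; rewrite !mxE.
    rewrite -val_eqE /= eq_sym ltn_eqF // sub0r; case: eqP => //= eji.
    by move: ltij; rewrite -eji ltnNge leqnSn.
  apply: big1 => i _; rewrite !mxE eqxx; case: eqP => [/esym/n_Sn|] //.
(* Since ['C(a, 0) = 1], row 0 of the product is 1, 0, ..., 0 and a single cofactor survives. *)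
rewrite -[LHS]mulr1 -detU -det_mulmx (expand_det_row _ ord0) big_ord_recl /=.
have ent0 i : (binmx a *m U) i ord0 = ('C(a ord0, i))%:Z.
  rewrite mxE (bigD1 ord0) //= !mxE /= big1 ?addr0 ?subr0 ?mulr1 //.
  by move=> k nk0; rewrite !mxE (negPf nk0) subr0 mulr0.
have entS i j : (binmx a *m U) i (lift ord0 j) =
   ('C(a (lift ord0 j), i))%:Z - ('C(a (widen_ord (leqnSn n) j), i))%:Z.
  rewrite mxE (bigD1 (lift ord0 j)) //= (bigD1 (widen_ord (leqnSn n) j)) /=; last first.
    by rewrite -val_eqE /= ltn_eqF // /bump.
  rewrite !mxE big1 ?addr0 => [|k /andP[nk1 nk2]].
    rewrite -!val_eqE /= /bump /= !add1n !eqxx [j.+2 == _]gtn_eqF // [_ == _ :> nat]ltn_eqF //.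
    by rewrite sub0r subr0 mulr1 mulrN1.
  rewrite !mxE (negPf nk1) /= /bump /= add1n eqSS.
  by move: nk2; rewrite -val_eqE /= => /negPf->; rewrite subr0 mulr0.
rewrite big1 => [|j _].
  rewrite ent0 addr0 bin0 mul1r /cofactor /= expr0 mul1r; congr (\det _).
  by apply/matrixP => i j; do 2 rewrite [LHS]mxE; rewrite entS mxE.
by rewrite entS !bin0 subrr mul0r.
Qed.

Lemma det_binmx (n : nat) (a : 'I_n -> nat) :
  (\prod_(i < n) i`!)%:Z * \det (binmx a) =
  \prod_(i < n) \prod_(j < n | (i < j)%N) ((a j)%:Z - (a i)%:Z).
Proof.
(* The falling factorials i! 'C(X, i) are monic of degree i, hence unitriangular
   in the powers of X. *)
pose ff i : {poly int} := \prod_(0 <= l < i) ('X - (l%:Z)%:P).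
have ffE i (k : nat) : (ff i).[k%:Z] = (k ^_ i)%:Z.
  elim: i => [|i IHi]; first by rewrite /ff big_geq // hornerC ffactn0.
  rewrite /ff big_nat_recr //= hornerM -/(ff i) IHi ffactnSr !hornerE.
  (* Natural subtraction [k - i] is exact for [i <= k]; otherwise [k ^_ i = 0] annihilates both
     sides. *)
  case: (leqP i k) => [leik|ltki]; first by rewrite subzn // PoszM.
  by rewrite ffact_small // !mul0r mul0n.
have sz i : size (ff i) = i.+1 by rewrite size_prod_XsubC size_iota subn0.
have mon i : ff i \is monic by rewrite monic_prod_XsubC.
pose L : 'M[int]_n := \matrix_(i, k) (ff i)`_k.
pose v : 'rV[int]_n := \row_j (a j)%:Z.
have detL : \det L = 1.
  rewrite det_trig; last first.
    by apply/is_trig_mxP => i j ltij; rewrite mxE nth_default // sz.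
  apply: big1 => i _; rewrite mxE; have /monicP := mon i.
  by rewrite lead_coefE sz.
have -> : (\prod_(i < n) i`!)%:Z = \det (diag_mx (\row_(i < n) (i`!)%:Z)).
  rewrite det_diag; rewrite -[LHS](natz) natr_prod; apply: eq_bigr => i _.
  by rewrite mxE natz.
rewrite -det_mulmx.
(* The number [i! 'C(a_j, i)] is the value of [ff i] at [a_j]; row [i] of [L] expands it in powers
   of [a_j]. *)
have -> : diag_mx (\row_(i < n) (i`!)%:Z) *m binmx a = L *m Vandermonde n v.
  apply/matrixP => i j; rewrite mul_diag_mx !mxE -PoszM mulnC bin_ffact -ffE.
  rewrite (horner_coef_wide _ (n := n)) ?sz //.
  by apply: eq_bigr => k _; rewrite !mxE.
rewrite det_mulmx detL mul1r det_Vandermonde.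
by apply: eq_bigr => i _; apply: eq_bigr => j _; rewrite !mxE.
Qed.

End Determinant.

(** * Independent choices, and ranks in a set of values *)

Lemma card_forall_ffun (T V : finType) (P : T -> pred V) :
  #|[set h : {ffun T -> V} | [forall t, P t (h t)]]| = \prod_t #|[set v | P t v]|.
Proof.
under eq_bigr => t _ do rewrite -sum1dep_card.
rewrite bigA_distr_big_dep -sum1dep_card.
by apply: eq_big => [h|h _]; rewrite ?big1.
Qed.

Section Intervals.
Variables (N : nat) (A : {set 'I_N}).

(** At the diagonal entry [e_i] this is the number [a_i] of the counting formulas. The argument is
    any natural number because diagonal entries need not lie in [A]. *)
Definition rank (v : nat) := \sum_(u in A | u < v) 1.

Lemma sum_interval_recr (F : 'I_N -> nat) (a b : nat) : a <= b ->
  \sum_(v in A | a <= v < b.+1) F v =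
  \sum_(v in A | a <= v < b) F v + \sum_(v in A | v == b :> nat) F v.
Proof.
move=> leab; rewrite (bigID (fun v : 'I_N => v < b)) /=; congr (_ + _).
  apply: eq_bigl => v; case: (v \in A) => //=.
  by case: (a <= v) => //=; rewrite ltnS andbC; case: ltnP => // /ltnW ->.
apply: eq_bigl => v; case: (v \in A) => //=; rewrite -leqNgt ltnS -andbA -eqn_leq.
by case: eqP => [->|]; rewrite ?leab ?andbF.
Qed.

(** A hockey-stick identity along [A]: if [b] is in [A], the rank grows by one from [b] to [b.+1]
    and Pascal's rule adds ['C(rank b, i)]; otherwise nothing changes. The case [i = 0] measures
    intervals. *)
Lemma sum_bin_rank (i a b : nat) : a <= b ->
  'C(rank b, i.+1) = 'C(rank a, i.+1) + \sum_(v in A | a <= v < b) 'C(rank v, i).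
Proof.
elim: b => [|b IHb]; first by rewrite leqn0 => /eqP->; rewrite big1 ?addn0 // => v /andP[].
rewrite leq_eqVlt => /predU1P[->|]; last rewrite ltnS => leab.
  by rewrite big1 ?addn0 // => v /and3P[_ /leq_ltn_trans H /H]; rewrite ltnn.
rewrite sum_interval_recr // addnA -IHb //.
have -> : rank b.+1 = rank b + \sum_(v in A | v == b :> nat) 1.
  exact: (@sum_interval_recr (fun=> 1) 0 b).
case: (pickP (fun v : 'I_N => (v \in A) && (v == b :> nat))) => [u /andP[Au /eqP ub]|none].
  have E v : (v \in A) && (v == b :> nat) = (v == u).
    by rewrite -ub val_eqE andbC; case: eqP => // ->.
  by rewrite !(big_pred1 u) // ub addn1 binS.
by rewrite !big_pred0 // !addn0.
Qed.

Lemma leq_rank (a b : nat) : a <= b -> rank a <= rank b.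
Proof. by move/(sum_bin_rank 0); rewrite !bin1 => ->; rewrite leq_addr. Qed.

Lemma card_interval (a b : nat) : a <= b ->
  #|[set v in A | a <= v < b]| = rank b - rank a.
Proof.
move=> leab; have := sum_bin_rank 0 leab; rewrite !bin1 => ->; rewrite addKn.
by rewrite -sum1dep_card; apply: eq_bigr => v; rewrite bin0.
Qed.

End Intervals.

(** * A single page over a prescribed diagonal *)

Definition tri (n : nat) := {p : 'I_n * 'I_n | p.1 < p.2}.
Definition page (n N : nat) := {ffun tri n -> 'I_N}.

Section Pages.
Variables (n N : nat).
Implicit Types (x : 'I_n -> nat) (h : page n N) (i j : 'I_n).

(** The value [x i] is the diagonal entry when [i = j]; for [i > j] it is a default that the page
    conditions never read. *)
Definition page_entry x h i j : nat :=
  if @insub _ (fun p : 'I_n * 'I_n => p.1 < p.2) (tri n) (i, j) is Some p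
  then h p else x i.

Lemma page_entry_diag x h i : page_entry x h i i = x i.
Proof. by rewrite /page_entry insubF //= ltnn. Qed.

Lemma page_entry_off x h i j (ltij : i < j) :
  page_entry x h i j = h (exist _ (i, j) ltij).
Proof.
rewrite /page_entry insubT /=; congr (val (h _)); exact: val_inj.
Qed.

(* The half-open relaxations, relative to a diagonal x external to the page. *)
Definition page_selberg x h :=
  [forall i : 'I_n, forall j : 'I_n, (i < j) ==> (x i <= page_entry x h i j < x j)].

Definition page_young x h :=
  [forall i : 'I_n, forall j : 'I_n, forall j' : 'I_n,
     (i <= j < j') ==> (page_entry x h i j <= page_entry x h i j')] &&
  [forall i : 'I_n, forall i' : 'I_n, forall j : 'I_n,
     (i < i' <= j) ==> (page_entry x h i j < page_entry x h i' j)].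

Lemma page_selbergP x h :
  reflect (forall i j, i < j -> x i <= page_entry x h i j < x j) (page_selberg x h).
Proof.
apply: (iffP forallP) => [H i j|H i]; last by apply/forallP => j; apply/implyP/H.
by have /forallP/(_ j)/implyP := H i.
Qed.

Lemma page_youngP x h :
  reflect ((forall i j j' : 'I_n, i <= j -> j < j' ->
              page_entry x h i j <= page_entry x h i j') /\
           (forall i i' j : 'I_n, i < i' -> i' <= j ->
              page_entry x h i j < page_entry x h i' j))
          (page_young x h).
Proof.
apply: (iffP andP) => -[H1 H2]; split.
- by move=> i j j' a b; move/forallP/(_ i)/forallP/(_ j)/forallP/(_ j')/implyP: H1; rewrite a b => ->.
- by move=> i i' j a b; move/forallP/(_ i)/forallP/(_ i')/forallP/(_ j)/implyP: H2; rewrite a b => ->.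
- by apply/forallP => i; apply/forallP => j; apply/forallP => j'; apply/implyP => /andP[]; apply: H1.
- by apply/forallP => i; apply/forallP => i'; apply/forallP => j; apply/implyP => /andP[]; apply: H2.
Qed.

(** Row [i] rises weakly from its diagonal cell to [(i, j)], and column [j] rises strictly from
    there to its diagonal cell. *)
Lemma page_young_selberg x h : page_young x h -> page_selberg x h.
Proof.
move/page_youngP => [H1 H2]; apply/page_selbergP => i j ltij.
by rewrite -{1}(page_entry_diag x h i) -(page_entry_diag x h j) H1 ?H2.
Qed.

(** The cells are independent: cell [(i, j)] takes any element of [A] from [x i] on and below
    [x j]. *)
Lemma card_page_selberg (A : {set 'I_N}) x : {homo x : i j / i <= j} ->
  #|[set h : page n N | [forall p, h p \in A] && page_selberg x h]| =
  \prod_(i < n) \prod_(j < n | i < j) (rank A (x j) - rank A (x i)).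
Proof.
move=> homx; pose P (p : tri n) v := (v \in A) && (x (val p).1 <= v < x (val p).2).
transitivity #|[set h : page n N | [forall p, P p (h p)]]|.
  apply: eq_card => h; rewrite !inE; apply/andP/forallP.
    move=> [/forallP Ah /page_selbergP Sh] [[i j] /= ltij]; rewrite /P Ah /=.
    by have := Sh i j ltij; rewrite page_entry_off.
  move=> Ph; split; first by apply/forallP => p; have /andP[] := Ph p.
  apply/page_selbergP => i j ltij; rewrite page_entry_off.
  by have /andP[] := Ph (exist _ (i, j) ltij).
rewrite card_forall_ffun pair_big_dep /=.
rewrite (reindex_omap (val : tri n -> _) insub) /=; last first.
  by move=> p ltp; rewrite insubT.
apply: eq_big => [p|p _]; first by rewrite valK eqxx andbT (valP p).
by rewrite /P card_interval // homx // ltnW // (valP p).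
Qed.

End Pages.

(** * Removing the diagonal of a page *)

Lemma ord_ltn_widen_lift (n : nat) (i j : 'I_n.+1) : i < j ->
  exists i' j' : 'I_n,
    [/\ i = widen_ord (leqnSn n) i', j = lift ord0 j' & i' <= j'].
Proof.
move=> ltij; have lt_in : i < n by apply: leq_trans ltij (leq_ord j).
case: (unliftP ord0 j) => [j' jE|j0]; last by move: ltij; rewrite j0.
exists (Ordinal lt_in), j'; split=> //; first exact: val_inj.
by move: ltij; rewrite jE.
Qed.

Section Glue.
Variables (n N : nat).
Local Notation widen := (widen_ord (leqnSn n)).

(** Cell [(i, j)] of the smaller shape, diagonal included, becomes cell [(i, j + 1)] of the larger
    one, so the superdiagonal serves as the new diagonal. *)
Definition tri_shift (i j : 'I_n) (leij : i <= j) : tri n.+1 :=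
  exist (fun p : 'I_n.+1 * 'I_n.+1 => p.1 < p.2) (widen i, lift ord0 j) leij.

Lemma tri_low_subproof (p : tri n.+1) : (val p).1 < n.
Proof. exact: leq_trans (valP p) (leq_ord _). Qed.

Lemma tri_high_subproof (p : tri n.+1) : (val p).2.-1 < n.
Proof. by have := valP p; case: (val p).2 => [[]]. Qed.

Definition tri_low (p : tri n.+1) : 'I_n := Ordinal (tri_low_subproof p).
Definition tri_high (p : tri n.+1) : 'I_n := Ordinal (tri_high_subproof p).

Lemma tri_low_shift (i j : 'I_n) (leij : i <= j) : tri_low (tri_shift leij) = i.
Proof. exact: val_inj. Qed.

Lemma tri_high_shift (i j : 'I_n) (leij : i <= j) : tri_high (tri_shift leij) = j.
Proof. exact: val_inj. Qed.

Lemma tri_shiftP (p : tri n.+1) : exists (i j : 'I_n) (leij : i <= j), p = tri_shift leij.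
Proof.
case: p => -[i j] /= ltij; have [i' [j' [iE jE leij]]] := ord_ltn_widen_lift ltij.
by exists i', j', leij; apply: val_inj; rewrite /= iE jE.
Qed.

(** The values [y] fill the superdiagonal, which is exactly where [insub] fails, and [h] fills the
    cells further out. *)
Definition page_glue (y : {ffun 'I_n -> 'I_N}) (h : page n N) : page n.+1 N :=
  [ffun p => if insub (tri_low p, tri_high p) is Some q then h q
             else y (tri_low p)].

Definition page_superdiag (h : page n.+1 N) : {ffun 'I_n -> 'I_N} :=
  [ffun i : 'I_n => h (tri_shift (leqnn i))].

Definition page_trim (h : page n.+1 N) : page n N :=
  [ffun q : tri n => h (tri_shift (ltnW (valP q)))].

Lemma page_glue_diag y h (i : 'I_n) (leii : i <= i) : page_glue y h (tri_shift leii) = y i.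
Proof. by rewrite ffunE tri_low_shift tri_high_shift insubF //= ltnn. Qed.

Lemma page_glue_off y h (q : tri n) (leq_q : (val q).1 <= (val q).2) :
  page_glue y h (tri_shift leq_q) = h q.
Proof.
rewrite ffunE tri_low_shift tri_high_shift.
by rewrite -surjective_pairing valK.
Qed.

Lemma tri_shift_split (p : tri n.+1) :
  (exists i : 'I_n, p = tri_shift (leqnn i)) \/
  (exists q : tri n, p = tri_shift (ltnW (valP q))).
Proof.
have [i [j [leij ->]]] := tri_shiftP p.
have /predU1P[eqij|ltij] : (val i == val j) || (i < j) by rewrite -leq_eqVlt.
  by left; exists i; apply: val_inj; congr (_, _); apply: val_inj; rewrite /= -eqij.
by right; exists (exist _ (i, j) ltij); apply: val_inj.
Qed.

Lemma page_glue_bij : bijective (fun yh => page_glue yh.1 yh.2).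
Proof.
exists (fun h => (page_superdiag h, page_trim h)) => [[y h]|h] /=.
  congr (_, _); apply/ffunP => q; rewrite ffunE.
    exact: page_glue_diag.
  exact: page_glue_off.
apply/ffunP => p; have [[i ->]|[q ->]] := tri_shift_split p.
  by rewrite page_glue_diag ffunE.
by rewrite page_glue_off ffunE.
Qed.

Lemma page_entry_glue x y h (i j : 'I_n) : i <= j ->
  page_entry x (page_glue y h) (widen i) (lift ord0 j) =
  page_entry (fun i => y i) h i j.
Proof.
move=> leij; rewrite (page_entry_off _ _ (leij : widen i < lift ord0 j)).
rewrite -/(tri_shift leij) ffunE tri_low_shift tri_high_shift /page_entry.
by case: insub.
Qed.

(** Outer diagonal cells only begin rows and end columns, so comparing them with their neighbours on
    the superdiagonal is enough. Weak rows and strict columns yield half-open interlacing, as in a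
    Gelfand-Tsetlin pattern. *)
Lemma page_young_glue x y h :
  page_young x (page_glue y h) =
  [forall i, x (widen i) <= y i < x (lift ord0 i)] && page_young (fun i => y i) h.
Proof.
apply/page_youngP/andP => [[rows cols]|[/forallP xy /page_youngP[rows cols]]]; split.
- apply/forallP => i; rewrite -(page_entry_diag (fun i => y i) h) -!(page_entry_glue x) //.
  rewrite -(page_entry_diag x (page_glue y h) (widen i)) rows //=.
  by rewrite -(page_entry_diag x (page_glue y h) (lift ord0 i)) cols.
- apply/page_youngP; split=> [i j j' leij ltjj|i i' j lti lei].
    have leij' := leq_trans leij (ltnW ltjj).
    by rewrite -!(page_entry_glue x) //; apply: rows => //; apply: leqW.
  have leij := leq_trans (ltnW lti) lei.
  by rewrite -!(page_entry_glue x) //; apply: cols => //; apply: leqW.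
- move=> i j j' leij ltjj.
  have [i' [k [iE j'E leik]]] := ord_ltn_widen_lift (leq_ltn_trans leij ltjj).
  rewrite {}iE {}j'E in leij ltjj *; rewrite page_entry_glue //.
  (* A comparison starting on the outer diagonal passes through [y i']; any other lies within the
     inner page. *)
  have [eqij|neqij] := eqVneq (widen i') j.
    rewrite -eqij page_entry_diag; have /andP[le_xy _] := xy i'.
    apply: leq_trans le_xy _; rewrite -(page_entry_diag (fun i => y i) h).
    by move: leik; rewrite leq_eqVlt => /predU1P[/val_inj->|/rows->].
  have lt_ij : widen i' < j by rewrite ltn_neqAle leij andbT.
  have [i'' [l [iE jE leil]]] := ord_ltn_widen_lift lt_ij.
  move/(congr1 val): iE => /= /val_inj ii; rewrite -{}ii in leil.
  by rewrite jE page_entry_glue // rows //; move: ltjj; rewrite jE.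
- move=> i i' j lti lei.
  have [k [l [iE jE lekl]]] := ord_ltn_widen_lift (leq_trans lti lei).
  rewrite {}iE {}jE in lti lei *; rewrite page_entry_glue //.
  (* Dually, a column reaches the outer diagonal through [y l]. *)
  have [eqij|neqij] := eqVneq i' (lift ord0 l).
    rewrite eqij page_entry_diag; have /andP[_ lt_yx] := xy l.
    apply: leq_ltn_trans lt_yx; rewrite -(page_entry_diag (fun i => y i) h).
    by move: lekl; rewrite leq_eqVlt => /predU1P[/val_inj->|ltkl] //; apply: ltnW; apply: cols.
  have lt_ij : i' < lift ord0 l by rewrite ltn_neqAle lei andbT.
  have [i'' [l' [iE lE leil]]] := ord_ltn_widen_lift lt_ij.
  move/lift_inj: lE => ll; rewrite -{}ll in leil.
  by rewrite iE page_entry_glue // cols //; move: lti; rewrite iE.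
Qed.

Lemma page_glue_in (A : {set 'I_N}) y h :
  [forall p, page_glue y h p \in A] = [forall i, y i \in A] && [forall q, h q \in A].
Proof.
apply/forallP/andP => [Ag|[/forallP Ay /forallP Ah] p].
  split; apply/forallP => q.
    by rewrite -(page_glue_diag y h (leqnn q)).
  by rewrite -(page_glue_off y h (ltnW (valP q))).
by have [[i ->]|[q ->]] := tri_shift_split p; rewrite ?page_glue_diag ?page_glue_off.
Qed.

Lemma card_page_youngS (A : {set 'I_N}) (x : 'I_n.+1 -> nat) :
  #|[set h : page n.+1 N | [forall p, h p \in A] && page_young x h]| =
  \sum_(y : {ffun 'I_n -> 'I_N} |
          [forall i, (y i \in A) && (x (widen i) <= y i < x (lift ord0 i))])
    #|[set h : page n N | [forall p, h p \in A] && page_young (fun i => y i) h]|.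
Proof.
rewrite -sum1dep_card (reindex _ (onW_bij _ page_glue_bij)) /=.
under [RHS]eq_bigr => y _ do rewrite -sum1dep_card.
rewrite pair_big_dep; apply: eq_bigl => -[y h] /=.
rewrite page_glue_in page_young_glue; move: (page_young _ _) => Y.
rewrite !andbA; congr (_ && _); rewrite andbAC; congr (_ && _).
apply/andP/forallP => [[/forallP H1 /forallP H2] i|H]; first by rewrite H1 H2.
by split; apply/forallP => i; have /andP[] := H i.
Qed.

End Glue.

(** * Counting Young pages and comparing with Selberg pages *)

Section PageCount.
Local Open Scope ring_scope.
Import GRing.Theory.

(** Multilinearity of the determinant: column [j] depends on [y] only through [y j]. *)
Lemma sum_det_col (R : comNzRingType) (n : nat) (V : finType)
    (Q : 'I_n -> pred V) (F : 'I_n -> 'I_n -> V -> R) :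
  \sum_(y : {ffun 'I_n -> V} | [forall j, Q j (y j)])
     \det (\matrix_(i, j) F i j (y j)) =
  \det (\matrix_(i, j) \sum_(v | Q j v) F i j v).
Proof.
(* After transposition the Leibniz products run over columns, so their [j]th factor involves [y j]
   alone and sum and product can be exchanged. *)
under eq_bigr do rewrite -det_tr.
rewrite -[RHS]det_tr /determinant.
rewrite exchange_big /=; apply: eq_bigr => s _; rewrite -big_distrr /=; congr (_ * _).
under [RHS]eq_bigr do rewrite !mxE.
rewrite bigA_distr_big_dep; apply: eq_big => y; first by [].
by move=> _; apply: eq_bigr => j _; rewrite !mxE.
Qed.

Lemma card_page_young (N n : nat) (A : {set 'I_N}) (x : 'I_n -> nat) :
  {homo x : i j / (i <= j)%N} ->
  #|[set h : page n N | [forall p, h p \in A] && page_young x h]|%:Z =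
  \det (binmx (fun j => rank A (x j))).
Proof.
elim: n x => [|n IHn] x homx.
  rewrite det_mx00; congr Posz.
  rewrite (_ : [set h | _] = [set: _]).
    by rewrite cardsT card_ffun [X in (_ ^ X)%N]eq_card0 // => -[[[]]].
  apply/setP => h; rewrite !inE; apply/andP; split.
    by apply/forallP => -[[[]]].
  by apply/page_youngP; split; case.
rewrite card_page_youngS det_binmxS -[LHS]natz natr_sum.
pose Q (j : 'I_n) (v : 'I_N) :=
  ((v \in A) && (x (widen_ord (leqnSn n) j) <= v < x (lift ord0 j)))%N.
rewrite (eq_bigr (fun y : {ffun 'I_n -> 'I_N} =>
          \det (\matrix_(i, j) ('C(rank A (y j), i))%:Z))); last first.
  move=> y /forallP Qy; rewrite natz IHn // => i j leij.
  (* Interlacing makes [y] monotone: for [i < j], [y_i < x_(i+1) <= x_j <= y_j]. This allows the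
     induction hypothesis to be used. *)
  have [->//|neqij] := eqVneq i j.
  have /and3P[_ _ lty] := Qy i; have /and3P[_ ley _] := Qy j.
  apply: ltnW; apply: leq_trans lty _; apply: leq_trans ley; apply: homx => /=.
  by rewrite /bump /= add1n ltn_neqAle leij andbT.
(* Column [j] is summed over the elements of [A] from [x_j] on and below [x_(j+1)]; [sum_bin_rank]
   gives the differences of [det_binmxS]. *)
rewrite (sum_det_col Q (fun i _ v => ('C(rank A v, i))%:Z)); congr (\det _).
apply/matrixP => i j; rewrite !mxE (@sum_bin_rank _ A i (x (widen_ord (leqnSn n) j))).
  by rewrite PoszD addrC addKr -[RHS]natz natr_sum; apply: eq_bigr => v _; rewrite natz.
by apply: homx; rewrite /= leqW.
Qed.

Lemma card_page_ratio (N n : nat) (A : {set 'I_N}) (x : 'I_n -> nat) :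
  {homo x : i j / (i <= j)%N} ->
  #|[set h : page n N | [forall p, h p \in A] && page_selberg x h]| =
  ((\prod_(i < n) i`!) *
   #|[set h : page n N | [forall p, h p \in A] && page_young x h]|)%N.
Proof.
move=> homx; apply/eqP; rewrite -eqz_nat PoszM card_page_young // det_binmx.
rewrite card_page_selberg // -[X in X == _]natz natr_prod; apply/eqP.
apply: eq_bigr => i _; rewrite natr_prod; apply: eq_bigr => j ltij.
by rewrite natz subzn // leq_rank // homx // ltnW.
Qed.

End PageCount.

(** * Books as families of independent pages *)

Lemma card_tri (n : nat) : #|[pred p : 'I_n * 'I_n | p.1 < p.2]| = 'C(n, 2).
Proof.
rewrite -sum1_card -(pair_big_dep predT (fun i j : 'I_n => i < j) (fun _ _ => 1)) /=.
rewrite (exchange_big_dep predT) //= -bin2_sum big_mkord; apply: eq_bigr => j _.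
by rewrite (big_ord_narrow (ltnW (ltn_ord j))) sum1_card card_ord.
Qed.

Lemma card_offcell (n m : nat) : #|{: offcell n m}| = m * 'C(n, 2).
Proof.
rewrite card_sig -card_tri -[in RHS](card_ord m) -cardX.
by apply: eq_card => -[k p]; rewrite !inE.
Qed.

Section Books.
Variables (n m : nat).
Local Notation N := (ncells n m).
Implicit Types (e : {ffun 'I_n -> 'I_N}) (h : {ffun offcell n m -> 'I_N}) (k : 'I_m).

Definition book_page h k : page n N :=
  [ffun q : tri n => h (exist _ (k, val q) (valP q))].

Definition book_of_pages (H : {ffun 'I_m -> page n N}) : {ffun offcell n m -> 'I_N} :=
  [ffun p : offcell n m => H (val p).1 (exist _ (val p).2 (valP p))].

Lemma book_page_of_pages H k : book_page (book_of_pages H) k = H k.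
Proof. by apply/ffunP => q; rewrite !ffunE; congr (H k _); apply: val_inj. Qed.

Lemma book_of_pages_bij : bijective book_of_pages.
Proof.
exists (fun h => [ffun k => book_page h k]) => [H|h].
  by apply/ffunP => k; rewrite ffunE book_page_of_pages.
by apply/ffunP => -[[k p] ltp]; rewrite !ffunE; congr (h _); apply: val_inj.
Qed.

Lemma card_books (P : pred (page n N)) :
  #|[set h | [forall k, P (book_page h k)]]| = #|[set g | P g]| ^ m.
Proof.
rewrite -sum1dep_card (reindex _ (onW_bij _ book_of_pages_bij)) /= sum1dep_card.
transitivity (\prod_(k < m) #|[set g | P g]|); last by rewrite prod_nat_const card_ord.
rewrite -(card_forall_ffun (fun _ : 'I_m => P)).
apply: eq_card => H; rewrite !inE; apply: eq_forallb => k.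
by rewrite book_page_of_pages.
Qed.

(** Having values in [A] is a condition on each cell, hence splits over the pages. Being onto [A]
    does not, which is why [card_onto_scale] is applied afterwards. *)
Lemma card_books_in (A : {set 'I_N}) (P : pred (page n N)) :
  #|[set h | (ffun_image h \subset A) && [forall k, P (book_page h k)]]| =
  #|[set g : page n N | [forall p, g p \in A] && P g]| ^ m.
Proof.
rewrite -card_books; apply: eq_card => h; rewrite !inE.
apply/andP/forallP => [[/subsetP sA /forallP Ph] k|H].
  by rewrite Ph andbT; apply/forallP => p; rewrite ffunE sA // imset_f.
split; last by apply/forallP => k; have /andP[] := H k.
apply/subsetP => _ /imsetP[[[k p] ltp] _ ->].
have /andP[/forallP/(_ (exist _ p ltp)) + _] := H k; rewrite ffunE.
by congr (h _ \in A); apply: val_inj.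
Qed.

Lemma card_books_onto (x : 'I_n -> nat) (C : {set 'I_N}) : {homo x : i j / i <= j} ->
  #|[set h | (ffun_image h == C) && [forall k, page_selberg x (book_page h k)]]| =
  (\prod_(i < n) i`!) ^ m *
  #|[set h | (ffun_image h == C) && [forall k, page_young x (book_page h k)]]|.
Proof.
move=> homx; move: C; apply: card_onto_scale => A.
by rewrite !card_books_in card_page_ratio // expnMn.
Qed.

(** * Books with a prescribed diagonal *)

Definition mk_filling e h : filling n m :=
  [ffun c => match c with inl i => e i | inr p => h p end].

Lemma mk_filling_bij : bijective (fun eh => mk_filling eh.1 eh.2).
Proof.
exists (fun f : filling n m => ([ffun i => f (inl i)], [ffun p => f (inr p)])).
  by case=> e h; congr (_, _); apply/ffunP => c; rewrite !ffunE.
by move=> f; apply/ffunP => -[i|p]; rewrite !ffunE.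
Qed.

Lemma pentry_mk e h k i j :
  pentry (mk_filling e h) k i j =
  (page_entry (fun i => e i) (book_page h k) i j).+1.
Proof.
rewrite /pentry /page_entry; have [ltij|leji] := ltnP i j.
  by rewrite !insubT /= !ffunE; congr (val (h _)).+1; apply: val_inj.
by rewrite !insubF /= ?ffunE // ltnNge leji.
Qed.

Lemma mk_selbergP e h :
  reflect (forall k (i j : 'I_n), i < j ->
             e i < page_entry (fun i => e i) (book_page h k) i j < e j)
          (selberg_cond (mk_filling e h)).
Proof.
apply: (iffP forallP) => [H k i j ltij|H k].
  have /forallP/(_ i)/forallP/(_ j)/implyP/(_ ltij) := H k.
  by rewrite !pentry_mk !page_entry_diag !ltnS.
apply/forallP => i; apply/forallP => j; apply/implyP => ltij.
by rewrite !pentry_mk !page_entry_diag !ltnS H.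
Qed.

(** There are as many off-diagonal cells as values missed by [e], so being injective and avoiding
    the values of [e] amounts to being onto the missed ones. *)
Lemma mk_filling_inj e h : injective e ->
  injectiveb (mk_filling e h) = (ffun_image h == ~: [set e i | i : 'I_n]).
Proof.
move=> inje; have cardC : #|~: [set e i | i : 'I_n]| = #|{: offcell n m}|.
  by rewrite cardsCs setCK card_imset // !card_ord card_offcell addKn.
apply/injectiveP/eqP => [injf|imh].
  apply/eqP; rewrite eqEcard cardC card_imset => [|p q eqh]; last first.
    by have [] : inr p = inr q :> cell n m by apply: injf; rewrite !ffunE.
  rewrite leqnn andbT; apply/subsetP => _ /imsetP[p _ ->]; rewrite inE.
  apply/imsetP => -[i _ eqhe].
  by have: inr p = inl i :> cell n m by apply: injf; rewrite !ffunE.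
have injh : injective h.
  have /imset_injP injh : #|h @: setT| == #|[set: offcell n m]|.
    by rewrite cardsT -cardC -imh; apply/eqP; apply: eq_card => v; apply/imsetP/imsetP => -[p _ ->]; exists p.
  by move=> p q; apply: injh; rewrite inE.
have neq p i : h p != e i.
  apply/eqP => eqhe; have : h p \in ffun_image h by apply: imset_f.
  by rewrite imh inE eqhe imset_f.
case=> [i|p] [j|q]; rewrite !ffunE => eqv.
- by rewrite (inje _ _ eqv).
- by have := neq q i; rewrite eqv eqxx.
- by have := neq p j; rewrite eqv eqxx.
- by rewrite (injh _ _ eqv).
Qed.

(** Upgrades the weak inequalities of the relaxed conditions to strict ones. *)
Lemma page_row_neq e h k (i j j' : 'I_n) :
  injective (mk_filling e h) -> i <= j -> j < j' ->
  page_entry (fun i => e i) (book_page h k) i j !=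
  page_entry (fun i => e i) (book_page h k) i j'.
Proof.
move=> injf leij ltjj; have ltij' := leq_ltn_trans leij ltjj.
rewrite (page_entry_off _ _ ltij') ffunE; apply/eqP.
have /predU1P[/val_inj <-|ltij] : (val i == val j) || (i < j) by rewrite -leq_eqVlt.
  rewrite page_entry_diag => /val_inj eqv.
  suff: inl i = inr (exist _ (k, (i, j')) ltij') :> cell n m by [].
  apply: injf; rewrite !ffunE eqv; congr (h _); exact: val_inj.
rewrite (page_entry_off _ _ ltij) ffunE => /val_inj eqv.
have : inr (exist _ (k, (i, j)) ltij) = inr (exist _ (k, (i, j')) ltij') :> cell n m.
  by apply: injf; rewrite !ffunE; move: eqv; congr (h _ = h _); apply: val_inj.
by case=> eqj; rewrite eqj ltnn in ltjj.
Qed.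

Lemma mk_SB e h : injective e ->
  (mk_filling e h \in SB n m) =
  (ffun_image h == ~: [set e i | i : 'I_n]) &&
  [forall k, page_selberg (fun i => e i) (book_page h k)].
Proof.
move=> inje; rewrite inE /is_bijective_filling -mk_filling_inj //.
apply: andb_id2l => /injectiveP injf; apply/mk_selbergP/forallP => [H k|H k i j ltij].
  by apply/page_selbergP => i j /(H k)/andP[/ltnW -> ->].
have /page_selbergP/(_ i j ltij)/andP[lei ->] := H k.
rewrite andbT ltn_neqAle lei andbT.
by rewrite -{1}(page_entry_diag (fun i => e i) (book_page h k) i) page_row_neq.
Qed.

Lemma mk_YB e h : injective e ->
  (mk_filling e h \in YB n m) =
  (ffun_image h == ~: [set e i | i : 'I_n]) &&
  [forall k, page_young (fun i => e i) (book_page h k)].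
Proof.
move=> inje; rewrite inE andbA.
have -> : is_bijective_filling (mk_filling e h) && selberg_cond (mk_filling e h) =
  (mk_filling e h \in SB n m) by rewrite inE.
rewrite mk_SB // -andbA -mk_filling_inj //.
apply: andb_id2l => /injectiveP injf; apply/andP/forallP => [[_ /andP[rows cols]] k|H].
  apply/page_youngP; split=> [i j j' leij ltjj|i i' j lti lei].
    move/forallP/(_ k)/forallP/(_ i)/forallP/(_ j)/forallP/(_ j')/implyP: rows.
    by rewrite leij ltjj !pentry_mk ltnS => /(_ isT)/ltnW.
  move/forallP/(_ k)/forallP/(_ i)/forallP/(_ i')/forallP/(_ j)/implyP: cols.
  by rewrite lti lei !pentry_mk ltnS => /(_ isT).
(* The relaxed row and column conditions already imply the Selberg inequalities. *)
split; first by apply/forallP => k; apply: page_young_selberg.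
apply/andP; split; apply/forallP => k; have /page_youngP[rows cols] := H k.
  apply/forallP => i; apply/forallP => j; apply/forallP => j'.
  apply/implyP => /andP[leij ltjj]; rewrite !pentry_mk ltnS ltn_neqAle rows // andbT.
  exact: page_row_neq.
apply/forallP => i; apply/forallP => i'; apply/forallP => j.
by apply/implyP => /andP[lti lei]; rewrite !pentry_mk ltnS cols.
Qed.

Lemma card_fixed_diag e : 0 < m ->
  #|[set h | mk_filling e h \in SB n m]| =
  (\prod_(i < n) i`!) ^ m * #|[set h | mk_filling e h \in YB n m]|.
Proof.
move=> m_gt0.
have [/'forall_forallP ince|notinc] :=
  boolP [forall i : 'I_n, forall j : 'I_n, (i < j) ==> (e i < e j)].
  have lte (i j : 'I_n) : i < j -> e i < e j by move/implyP: (ince i j).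
  have inje : injective e.
    by move=> i j eqe; apply: val_inj; case: (ltngtP i j) => // /lte; rewrite eqe ltnn.
  rewrite (eq_finset _ (fun h => mk_SB h inje)) (eq_finset _ (fun h => mk_YB h inje)).
  apply: card_books_onto => i j; rewrite leq_eqVlt => /predU1P[/val_inj->//|/lte/ltnW] //.
(* On page 0, which exists as [0 < m], a Selberg filling forces [e i < e j] for [i < j]. A diagonal
   violating this carries no book, and both counts vanish. *)
have SB0 h : mk_filling e h \notin SB n m.
  apply: contra notinc; rewrite inE => /andP[_ /mk_selbergP H].
  apply/'forall_forallP => i j; apply/implyP => ltij.
  by have /andP[] := H (Ordinal m_gt0) i j ltij; apply: ltn_trans.
rewrite !eq_card0 ?muln0 // => h; rewrite inE; last exact: negPf.
apply: contraNF (SB0 h); rewrite !inE => /and3P[-> ->] //.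
Qed.

(** * Summation over all diagonals *)

Lemma card_diag_pred (P : pred (filling n m)) (Q : pred {ffun 'I_n -> 'I_N}) :
  #|[set f | P f && Q [ffun i => f (inl i)]]| =
  \sum_(e | Q e) #|[set h | P (mk_filling e h)]|.
Proof.
rewrite -sum1dep_card (reindex _ (onW_bij _ mk_filling_bij)) /=.
under [RHS]eq_bigr => e _ do rewrite -sum1dep_card.
rewrite pair_big_dep; apply: eq_bigl => -[e h] /=; rewrite andbC; congr (Q _ && _).
by apply/ffunP => i; rewrite !ffunE.
Qed.

(** The ratio is the same over every diagonal. Taking the gap condition or [predT] as [Q] gives the
    refined or the total count. *)
Lemma card_SB_YB (Q : pred {ffun 'I_n -> 'I_N}) : 0 < m ->
  #|[set f | (f \in SB n m) && Q [ffun i => f (inl i)]]| =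
  (\prod_(i < n) i`!) ^ m *
  #|[set f | (f \in YB n m) && Q [ffun i => f (inl i)]]|.
Proof.
move=> m_gt0; rewrite !card_diag_pred big_distrr; apply: eq_bigr => e _.
exact: card_fixed_diag.
Qed.

End Books.

Theorem theorem3p5 (n m : nat) (hn : 0 < n) (hm : 0 < m) :
  (forall d : 'I_n.-1 -> nat,
     #|SBd n m d| = (\prod_(1 <= k < n) k`!) ^ m * #|YBd n m d|) /\
  #|SB n m| = (\prod_(1 <= k < n) k`!) ^ m * #|YB n m|.
Proof.
(* The products differ only by the factor 0! = 1 at index 0. *)
have -> : \prod_(1 <= k < n) k`! = \prod_(i < n) i`!.
  by rewrite -(big_mkord predT (fun i => i`!)) [RHS]big_ltn // fact0 mul1n.
split=> [d|].
  pose Q (e : {ffun 'I_n -> 'I_(ncells n m)}) :=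
    [forall i : 'I_n.-1, forall a : 'I_n, forall b : 'I_n,
     ((val a == val i) && (val b == (val i).+1)) ==>
       ((e b).+1 == (e a).+1 + d i + 1)].
  have gapsE f : gaps_cond d f = Q [ffun i => f (inl i)].
    apply: eq_forallb => i; apply: eq_forallb => a; apply: eq_forallb => b.
    by rewrite !ffunE.
  rewrite (_ : SBd n m d = [set f | (f \in SB n m) && Q [ffun i => f (inl i)]]).
    rewrite (_ : YBd n m d = [set f | (f \in YB n m) && Q [ffun i => f (inl i)]]).
      exact: card_SB_YB.
    by apply/setP => f; rewrite !inE gapsE.
  by apply/setP => f; rewrite !inE gapsE.
have := card_SB_YB (n := n) predT hm.
by congr (_ = _ * _); apply: eq_card => f; rewrite inE andbT.
Qed.
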